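(* Let $\mathbf{s}$ be a sequence of pairs of positive integers. Then: (1) if $n(\mathbf{s})\leq 2$, then $\theta(\mathbf{s},q)=-\infty$ for every $q$; (2) if $n(\mathbf{s})=3$, then $\lim_{q\to\infty}\theta(\mathbf{s},q)=0$.
   Context: Throughout, $q$ ranges over prime powers and $k=\mathbb{F}_q$ is the finite field with $q$ elements. For a (finite, nonempty) sequence $\mathbf{s}=\{(e_1,f_1),\ldots,(e_t,f_t)\}$ of pairs of positive integers (repetitions allowed), put $n(\mathbf{s}):=\sum_i e_if_i$ and, for each $q$, let $B_{\mathbf{s}}:=\prod_{i=1}^t\mathbb{F}_{q^{e_i}}[X]/(X^{f_i})$, regarded as a $k$-algebra via the diagonal embedding of $k$; $n(\mathbf{s})=\dim_k B_{\mathbf{s}}$. For a finite $k$-algebra $B$, let $\mathcal{F}_0(k,B)$ be the set of $k$-subspaces $I$ of $B$ with $IB=B$. For a subset $I\subseteq B$ and $b\in B$ let $(I:b):=\{x\in B\mid bx\in I\}$. A closure operation on a partially ordered set is an extensive, order-preserving, idempotent self-map. A multiplicative operation on $(k,B,\mathcal{F}_0(k,B))$ is a closure operation $I\mapsto I^\star$ on $\mathcal{F}_0(k,B)$ (ordered by inclusion) such that $(I:b)^\star\subseteq(I^\star:b)$ for all $I\in\mathcal{F}_0(k,B)$ and all $b\in B$ with $(I:b)\in\mathcal{F}_0(k,B)$. A star operation on $(k,B)$ is a multiplicative operation $\star$ on $(k,B,\mathcal{F}_0(k,B))$ with $k^\star=k$; $\mathrm{Star}(k,B)$ is the set of all of them.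 Set $\Lambda(\mathbf{s},q):=|\mathrm{Star}(k,B_{\mathbf{s}})|$ and $\theta(\mathbf{s},q):=\log_q\log_2\Lambda(\mathbf{s},q)$, with the convention $\log_q 0=-\infty$. *)

(* Defs.v *)
From HB Require Import structures.
From mathcomp Require Import all_boot all_order all_fingroup all_algebra.
From mathcomp Require Import all_solvable all_field.
From mathcomp Require Import all_classical all_reals all_analysis.

Set Implicit Arguments.
Unset Strict Implicit.
Unset Printing Implicit Defensive.

Import Order.TTheory GRing.Theory Num.Theory.

Local Open Scope ring_scope.

Definition prime_power (q : nat) : Prop :=
  exists p r : nat, [/\ prime p, (0 < r)%N & q = (p ^ r)%N].

Lemma field_ext_exists (k : finFieldType) (n : nat) : (0 < n)%N ->
  {L : fieldExtType k | \dim {:L} = n}.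
Proof.
move=> n_gt0; set c := #|k|; set m := (c ^ n)%N.
have c_gt1 : (1 < c)%N by apply: finNzRing_gt1.
have m_gt1 : (1 < m)%N by rewrite -(expn0 c) ltn_exp2l.
have m_gt0 := ltnW m_gt1; have m1_gt0 : (0 < m.-1)%N by rewrite -ltnS prednK.
pose f (A : nzRingType) : {poly A} := 'X^m - 'X.
have Df A : f A = ('X^(m.-1) - 1) * ('X - 0).
  by rewrite subr0 mulrBl mul1r -exprSr prednK.
have /FinSplittingFieldFor[/= L splitLf] : f k != 0.
  by rewrite Df monic_neq0 ?rpredM ?monicXsubC ?monicXnsubC.
rewrite [map_poly _ _]rmorphB rmorphXn /= map_polyX -/(f L) in splitLf.
exists L.
have [p p_pr pchark] := finPcharP k.
have pcharL : p \in [pchar L] by rewrite pchar_lalg.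
have p_dvd_m : (p %| m)%N.
  rewrite (dvdn_pcharf pchark) natrX; suff -> : c%:R = 0 :> k.
    by rewrite expr0n gtn_eqF.
  apply/eqP; rewrite -(dvdn_pcharf pchark).
  have /is_abelemP[p1 p1_pr /abelem_pgroup/p_natP[j]] := finField_is_abelem k.
  rewrite cardsT -/c => Dc.
  have := card_finPcharP Dc p1_pr; rewrite (pcharf_eq pchark) => /eqP ep.
  rewrite Dc; move: Dc; case: j => [|j]; first by move=> c1; rewrite c1 in c_gt1.
  by rewrite expnS; move=> _; rewrite ep dvdn_mulr.
have /finField_galois_generator[/= a _ Da] : (1 <= {:L})%VS by apply: sub1v.
pose E := fixedSpace (a ^+ n)%g; rewrite dimv1 expn1 -/c in Da.
have{splitLf} [zs DfL defL] := splitLf.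
have Uzs : uniq zs.
  rewrite -separable_prod_XsubC -(eqp_separable DfL) Df separable_root andbC.
  rewrite /root !hornerE subr_eq0 eq_sym expr0n gtn_eqF ?oner_eq0 //=.
  rewrite cyclotomic.separable_Xn_sub_1 // -subn1 natrB // subr_eq0.
  have /eqP -> : m%:R == 0 :> L by rewrite -(dvdn_pcharf pcharL).
  by rewrite eq_sym oner_eq0.
have in_zs : zs =i E.
  move=> z; rewrite -root_prod_XsubC -(eqp_root DfL) (sameP fixedSpaceP eqP).
  rewrite /root !hornerE subr_eq0 /= /m; congr (_ == z).
  elim: (n) => [|i IHi]; first by rewrite gal_id.
  by rewrite expgSr expnSr exprM IHi galM ?Da ?memvf.
have defE : E = {:L}%VS.
  apply/eqP; rewrite eqEsubv subvf -defL -[E]subfield_closed agenvS //.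
  by rewrite subv_add sub1v; apply/span_subvP=> z; rewrite in_zs.
have cardL : #|finvect_type L| = m.
  have /eq_card-> : finvect_type L =i zs by move=> z; rewrite in_zs defE memvf.
  apply: succn_inj; rewrite (card_uniqP _) //= -(size_prod_XsubC _ id).
  by rewrite -(eqp_size DfL) size_polyDl size_polyXn // size_polyN size_polyX.
have := card_vspace (fullv : {vspace finvect_type L}).
rewrite card_vspacef cardL => /eqP; rewrite eqn_exp2l // => /eqP.
by move=> ->.
Qed.

(* Meaningful for n > 0 only: the degree is n.-1.+1. *)
Definition field_ext (k : finFieldType) (n : nat) : fieldExtType k :=
  sval (field_ext_exists k (ltn0Sn n.-1)).

Lemma dim_field_ext (k : finFieldType) (n : nat) : (0 < n)%N ->
  \dim {:field_ext k n} = n.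
Proof. by move=> n_gt0; rewrite (svalP (field_ext_exists _ _)) prednK. Qed.

(* The finite field with #|k| ^ n elements, as an extension of k. *)
Notation fin_ext k n := (finvect_type (field_ext k n)).

Lemma card_fin_ext (k : finFieldType) (n : nat) : (0 < n)%N ->
  #|fin_ext k n| = (#|k| ^ n)%N.
Proof.
move=> n_gt0; have := card_vspace (fullv : {vspace fin_ext k n}).
by rewrite card_vspacef dim_field_ext.
Qed.

(* For a prime power q, the field with q elements: pdiv q is its
   characteristic and 'F_(pdiv q) its prime field. *)
Definition GF (q : nat) : finFieldType :=
  fin_ext 'F_(pdiv q) (logn (pdiv q) q).

Lemma card_GF (q : nat) : prime_power q -> #|GF q| = q.
Proof.
move=> [p [[|r] [p_pr // _ ->]]].
by rewrite /GF pdiv_pfactor // pfactorK // card_fin_ext // card_Fp.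
Qed.

(* The ring A over L, seen as a k-algebra through k -> L, c |-> c%:A. *)
Definition restrict_scalars (k : finFieldType) (L : algType k)
  (A : finAlgType L) : Type := A.

Section RestrictScalars.
Variables (k : finFieldType) (L : algType k) (A : finAlgType L).
Local Notation rA := (restrict_scalars A).

HB.instance Definition _ := FinRing.NzRing.on rA.

Definition rscale (c : k) (x : rA) : rA := (c%:A : L) *: (x : A).

Lemma rscaleA a b x : rscale a (rscale b x) = rscale (a * b) x.
Proof. by rewrite /rscale scalerA -scalerAl mul1r scalerA. Qed.

Lemma rscale1 : left_id 1 rscale.
Proof. by move=> x; rewrite /rscale !scale1r. Qed.

Lemma rscaleDr : right_distributive rscale +%R.
Proof. by move=> a x y; apply: (@scalerDr L A). Qed.

Lemma rscaleDl x : {morph rscale^~ x : a b / a + b}.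
Proof. by move=> a b; rewrite /rscale !scalerDl. Qed.

HB.instance Definition _ := GRing.Zmodule_isLmodule.Build k rA
  rscaleA rscale1 rscaleDr rscaleDl.

Lemma rscaleAl (a : k) (u v : rA) : a *: (u * v) = (a *: u) * v.
Proof. exact: (@scalerAl L A). Qed.

HB.instance Definition _ := GRing.Lmodule_isLalgebra.Build k rA rscaleAl.

Lemma rscaleAr (a : k) (u v : rA) : a *: (u * v) = u * (a *: v).
Proof. exact: (@scalerAr L A). Qed.

HB.instance Definition _ := GRing.Lalgebra_isAlgebra.Build k rA rscaleAr.

HB.instance Definition _ := Finite.on rA.

End RestrictScalars.

(* L[X] / (X^f), f > 0: {poly %/ h} is the quotient by h only if h is monic and
   not constant. *)
Definition truncated_poly (L : finFieldType) (f : nat) : finAlgType L :=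
  {poly %/ ('X^f : {poly L})}.

Definition local_factor (k : finFieldType) (p : nat * nat) : finAlgType k :=
  @restrict_scalars k (fin_ext k p.1) (truncated_poly (fin_ext k p.1) p.2).

HB.instance Definition _ (k : finFieldType) (A B : finAlgType k) :=
  Finite.on (A * B)%type.

Fixpoint prod_factors (k : finFieldType) (p : nat * nat) (s : seq (nat * nat))
    : finAlgType k :=
  if s is p' :: s' then (local_factor k p * prod_factors k p' s')%type
  else local_factor k p.

(* The zero ring is not a finAlgType: s must be nonempty. *)
Definition Balg (k : finFieldType) (s : seq (nat * nat)) : finAlgType k :=
  prod_factors k (head (1, 1)%N s) (behead s).

Definition positive_pairs (s : seq (nat * nat)) : bool :=
  all (fun p => (0 < p.1)%N && (0 < p.2)%N) s.

Definition total_degree (s : seq (nat * nat)) : nat :=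
  (\sum_(p <- s) p.1 * p.2)%N.

Lemma card_local_factor (k : finFieldType) p : (0 < p.1)%N -> (0 < p.2)%N ->
  #|local_factor k p| = (#|k| ^ (p.1 * p.2))%N.
Proof.
move=> e_gt0 f_gt0.
rewrite -[LHS]/#|{poly %/ ('X^(p.2) : {poly fin_ext k p.1})}|.
rewrite card_npoly card_fin_ext // expnM; congr (_ ^ _)%N.
by rewrite /mk_monic size_polyXn monicXn ltnS f_gt0 /= size_polyXn.
Qed.

Lemma card_Balg (k : finFieldType) s : s <> [::] -> positive_pairs s ->
  #|Balg k s| = (#|k| ^ total_degree s)%N.
Proof.
case: s => // p s _; rewrite /Balg /total_degree /=.
elim: s p => [|p' s IHs] p /andP[/andP[e0 f0] ps].
  by rewrite big_seq1 card_local_factor.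
by rewrite card_prod card_local_factor // IHs // [in RHS]big_cons expnD.
Qed.

Section StarOperations.
Variables (k : finFieldType) (B : finAlgType k).
Implicit Types (I J : {set B}) (b : B).

Definition prod_span I J : {set B} :=
  [set b | `[< exists n (x y : 'I_n -> B),
    [/\ forall i, x i \in I, forall i, y i \in J & b = \sum_i x i * y i] >]].

Definition F0 : {set {set B}} :=
  [set I : {set B} | `[< GRing.submod_closed I >] &
                     prod_span I [set: B] == [set: B]].

Record F0type : predArgType :=
  F0Sub { F0val :> {set B}; F0valP : F0val \in F0 }.
HB.instance Definition _ := [isSub for F0val].
HB.instance Definition _ := [Finite of F0type by <:].

Definition colon I b : {set B} := [set x | b * x \in I].

Definition base_set : {set B} := [set c%:A | c : k].

Lemma base_set_F0 : base_set \in F0.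
Proof.
rewrite inE; apply/andP; split.
  apply/asboolP; split; first by apply/imsetP; exists 0; rewrite ?scale0r.
  move=> a _ _ /imsetP[c _ ->] /imsetP[d _ ->]; apply/imsetP.
  by exists (a * c + d); rewrite // scalerDl scalerA.
apply/eqP/setP=> b; rewrite !inE; apply/asboolP.
exists 1%N, (fun _ => 1), (fun _ => b); split=> [_|_|].
- by apply/imsetP; exists 1; rewrite ?scale1r.
- by rewrite inE.
- by rewrite big_ord1 mul1r.
Qed.

Definition closure_operation (star : F0type -> F0type) : Prop :=
  [/\ forall I : F0type, I \subset star I,
      forall I J : F0type, I \subset J -> star I \subset star J
    & forall I : F0type, star (star I) = star I].

Definition multiplicative_operation (star : F0type -> F0type) : Prop :=
  closure_operation star /\
  forall (I : F0type) (b : B) (Ib : colon I b \in F0),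
    star (F0Sub Ib) \subset colon (star I) b.

Definition star_operation (star : F0type -> F0type) : Prop :=
  multiplicative_operation star /\
  star (F0Sub base_set_F0) = F0Sub base_set_F0.

Definition Star : {set {ffun F0type -> F0type}} :=
  [set star : {ffun F0type -> F0type} | `[< star_operation star >]].

End StarOperations.

Definition Lambda (s : seq (nat * nat)) (q : nat) : nat :=
  #|Star (Balg (GF q) s)|.

(* The logarithm in base b > 1, with elog b 0 = -oo (from lne 0 = -oo). *)
Definition elog {R : realType} (b : R) (x : \bar R) : \bar R :=
  (lne x * ((ln b)^-1)%:E)%E.

Definition theta (R : realType) (s : seq (nat * nat)) (q : nat) : \bar R :=
  elog q%:R (elog 2 (Lambda s q)%:R%:E).

(* Main.v *)
(* A star operation is determined by its closed subspaces, and being closed is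
   invariant under I |-> (I : u) for u a unit.  The lines of F_0(k, B) are the
   u k with u a unit, hence always closed, as is B; for dim B <= 2 there is
   nothing else and the identity is the only star operation.

   If dim B = 3, the remaining subspaces are planes.  B is a Frobenius algebra:
   for a suitable linear form lam every plane is (ker lam : b) for some b, and b
   is a unit times one of the prod_i (f_i + 1) products of powers of X.  So there
   are at most 2 ^ (prod_i (f_i + 1)) star operations, uniformly in q.  There are
   at least two, because closing every plane to B is a star operation different
   from the identity.  Hence 0 <= theta <= log_q (prod_i (f_i + 1)). *)

Require Import Defs.
From mathcomp Require Import all_boot all_order all_algebra all_field.
From mathcomp Require Import all_classical all_reals all_analysis.

Set Implicit Arguments.
Unset Strict Implicit.
Unset Printing Implicit Defensive.

(* classical_sets shadows setX, eqEsubset, etc. *)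
Import fintype boot.finset.
Import numFieldNormedType.Exports.
Import Order.TTheory GRing.Theory Num.Theory.
Local Open Scope ring_scope.

(** * Subspaces of [B] as finite sets, with cardinalities in place of dimensions *)

Section Subspaces.
Variables (k : finFieldType) (B : finAlgType k).
Implicit Types (I J : {set B}) (x y b u : B).

(** The subspace I + k y. Each new vector multiplies the cardinality by [#|k|], which is how
    dimensions are measured throughout. *)
Definition add_line I y : {set B} := [set p.1 + p.2 *: y | p in setX I [set: k]].
Definition line x : {set B} := add_line [set 0] x.

Lemma lineP x z : reflect (exists c, z = c *: x) (z \in line x).
Proof.
apply: (iffP imsetP) => [[[a c]]|[c ->]].
  by rewrite !inE andbT /= => /eqP -> ->; exists c; rewrite add0r.
by exists (0, c); rewrite ?add0r // !inE eqxx.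
Qed.

Lemma submodN1 I : submod_closed I -> forall x y, x \in I -> y \in I -> x - y \in I.
Proof. by case=> _ Il x y Ix Iy; rewrite addrC -scaleN1r Il. Qed.

Lemma submodZ I : submod_closed I -> forall a x, x \in I -> a *: x \in I.
Proof. by case=> I0 Il a x Ix; rewrite -[a *: x]addr0 Il. Qed.

Lemma submod_set0 : submod_closed [set 0 : B].
Proof.
split=> [|a u v]; first by rewrite !inE.
by rewrite !inE => /eqP -> /eqP ->; rewrite scaler0 addr0.
Qed.

Lemma submod_add_line I y : submod_closed I -> submod_closed (add_line I y).
Proof.
case=> I0 Il; split=> [|a x z /imsetP[[u c]]].
  by apply/imsetP; exists (0, 0); rewrite ?inE ?I0 // scale0r addr0.
rewrite !inE andbT /= => Iu -> /imsetP[[v d]]; rewrite !inE andbT /= => Iv ->.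
apply/imsetP; exists (a *: u + v, a * c + d); first by rewrite !inE Il.
by rewrite /= scalerDr scalerDl scalerA addrACA.
Qed.

Lemma submod_line x : submod_closed (line x).
Proof. exact/submod_add_line/submod_set0. Qed.

Lemma card_add_line I y : submod_closed I -> y \notin I ->
  #|add_line I y| = (#|I| * #|k|)%N.
Proof.
move=> Is yI; rewrite card_in_imset ?cardsX ?cardsT //.
move=> [u c] [v d]; rewrite !inE !andbT /= => Iu Iv E.
have {}E : (c - d) *: y = v - u.
  by apply/eqP; rewrite scalerBl subr_eq addrAC eq_sym subr_eq -E addrC.
have [cd|cd] := eqVneq (c - d) 0.
  move: E; rewrite cd scale0r => /esym/eqP; rewrite subr_eq0 => /eqP ->.
  by move/eqP: cd; rewrite subr_eq0 => /eqP ->.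
case/negP: yI; rewrite -[y]scale1r -(mulVf cd) -scalerA E.
by apply: submodZ => //; apply: submodN1.
Qed.

Lemma card_line x : x != 0 -> #|line x| = #|k|.
Proof.
move=> x0; rewrite card_add_line ?cards1 ?mul1n ?inE //; exact: submod_set0.
Qed.

Lemma add_line_sub I J y : submod_closed J -> I \subset J -> y \in J ->
  add_line I y \subset J.
Proof.
move=> Js /subsetP IJ Jy; apply/subsetP=> _ /imsetP[[u c] + ->].
rewrite inE /= inE andbT addrC => /IJ Ju; case: Js => _; exact.
Qed.

Lemma line_sub J x : submod_closed J -> x \in J -> line x \subset J.
Proof. by move=> Js; apply: add_line_sub => //; rewrite sub1set; case: Js. Qed.

Lemma sub_add_line I y : I \subset add_line I y.
Proof.
apply/subsetP=> u Iu; apply/imsetP; exists (u, 0); first by rewrite !inE Iu.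
by rewrite scale0r addr0.
Qed.

Lemma submod_setT : submod_closed [set: B].
Proof. by split=> [|? ? ? ? ?]; rewrite inE. Qed.

Lemma submod_colon I b : submod_closed I -> submod_closed (colon I b).
Proof.
case=> I0 Il; split=> [|a u v]; first by rewrite inE mulr0.
by rewrite !inE => Iu Iv; rewrite mulrDr -scalerAr Il.
Qed.

(** An expression of 1 as an element of I B gives one for every b, on multiplying the second factors
    by b. *)
Lemma F0P I : reflect (submod_closed I /\ exists n (x y : 'I_n -> B),
   (forall i, x i \in I) /\ \sum_i x i * y i = 1) (I \in F0 B).
Proof.
rewrite [_ \in F0 B]inE; apply: (iffP andP) =>
  [[/asboolP Is /eqP I1]|[Is [n [x [y [Ix E]]]]]].
  split=> //; have : 1 \in prod_span I [set: B] by rewrite I1 inE.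
  by rewrite inE => /asboolP[n [x [y [? _ ->]]]]; exists n, x, y.
split; first exact/asboolP.
apply/eqP/setP=> b; rewrite !inE; apply/asboolP.
exists n, x, (fun i => y i * b); split=> //.
by rewrite -[LHS]mul1r -E mulr_suml; apply: eq_bigr => i _; rewrite mulrA.
Qed.

Lemma F0_submod I : I \in F0 B -> submod_closed I.
Proof. by case/F0P. Qed.

Lemma mem1_F0 I : submod_closed I -> 1 \in I -> I \in F0 B.
Proof.
move=> Is I1; apply/F0P; split=> //; exists 1%N, (fun=> 1), (fun=> 1).
by split=> //; rewrite big_ord1 mulr1.
Qed.

Lemma setT_F0 : [set: B] \in F0 B.
Proof. by apply: mem1_F0; rewrite ?inE //; apply: submod_setT. Qed.

Lemma F0_annihilator I b : I \in F0 B -> (forall x, x \in I -> b * x = 0) -> b = 0.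
Proof.
case/F0P=> _ [n [x [y [Ix E]]]] bI; rewrite -[b]mulr1 -E mulr_sumr.
by rewrite big1 // => i _; rewrite mulrA bI // mul0r.
Qed.

(** If 1 is the sum of the (c_i u) y_i, then the sum of the c_i y_i is an inverse of u. *)
Lemma line_F0_unit u : line u \in F0 B -> exists v, u * v = 1.
Proof.
case/F0P=> _ [n [x [y [Ix E]]]].
have [c xE] := choice (fun i => lineP u (x i) (Ix i)).
exists (\sum_i c i *: y i); rewrite mulr_sumr -E; apply: eq_bigr => i _.
by rewrite xE -scalerAr -scalerAl.
Qed.

Lemma F0_line_or_plane I : I \in F0 B ->
  (exists u v, u * v = 1 /\ I = line u) \/
  (exists x y, [/\ x != 0, y \notin line x & add_line (line x) y \subset I]).
Proof.
move=> I0; have Is := F0_submod I0.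
(* I is nonzero, as otherwise 1 would annihilate it. *)
have [x Ix x0] : exists2 x, x \in I & x != 0.
  case: (pickP [pred x in I | x != 0]) => [x /andP[]|no]; first by exists x.
  case/eqP: (oner_neq0 B); apply: (F0_annihilator I0) => x Ix.
  by move: (no x); rewrite /= Ix mul1r => /negbFE/eqP.
have [Il|/subsetPn[y Iy yl]] := boolP (I \subset line x); last first.
  right; exists x, y; split=> //; apply: add_line_sub => //; exact: line_sub.
left; have E : I = line x by apply/eqP; rewrite eqEsubset Il line_sub.
by rewrite E in I0 *; have [v] := line_F0_unit I0; exists x, v.
Qed.

(** I has codimension at most 1: adding to it any z in J outside I already gives [#|B|] elements. *)
Lemma submod_subset_card I J n : #|B| = (#|k| ^ n.+1)%N ->
  submod_closed I -> submod_closed J -> I \subset J -> (#|k| ^ n <= #|I|)%N -> J = I \/ J = [set: B].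
Proof.
move=> cB Is Js IJ cI; have [JI|/subsetPn[z Jz zI]] := boolP (J \subset I).
  by left; apply/eqP; rewrite eqEsubset JI IJ.
right; apply/eqP; rewrite -subTset.
suff <- : add_line I z = [set: B] by apply: add_line_sub.
apply/eqP; rewrite eqEcard subsetT cardsT cB card_add_line // expnSr leq_mul2r cI.
by rewrite orbT.
Qed.

End Subspaces.

(** * Closed subspaces of a star operation, and the case of dimension at most 2 *)

Section ClosedSubspaces.
Variables (k : finFieldType) (B : finAlgType k).
Implicit Types (I J : F0type B) (star : F0type B -> F0type B) (b x y u v : B).

(** Multiplicativity gives (I : b)^* inside (I^* : b) = (I : b), and extensivity gives the other
    inclusion. *)
Lemma fixed_colon star : multiplicative_operation star ->
  forall I J b, star I = I -> F0val J = colon I b -> star J = J.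
Proof.
move=> [[ext _ _] mult] I J b sI EJ; apply: val_inj; apply/eqP.
rewrite eqEsubset /= ext andbT.
have Jb : colon I b \in F0 B by rewrite -EJ F0valP.
have -> : J = F0Sub Jb by apply: val_inj.
by apply: subset_trans (mult _ _ _) _; rewrite sI.
Qed.

(** [star2 I] contains I and is fixed by [star2], hence by [star1]; monotonicity of [star1] then
    concludes. *)
Lemma closure_sub_of_fixed star1 star2 :
  closure_operation star1 -> closure_operation star2 ->
  (forall I, star2 I = I -> star1 I = I) -> forall I, star1 I \subset star2 I.
Proof.
move=> [_ mono1 _] [ext2 _ idem2] sub I.
by rewrite -(sub _ (idem2 I)); apply/mono1/ext2.
Qed.

Lemma closure_eq_fixed star1 star2 :
  closure_operation star1 -> closure_operation star2 ->
  (forall I, star1 I = I <-> star2 I = I) -> star1 =1 star2.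
Proof.
move=> c1 c2 fixE I; apply: val_inj; apply/eqP; rewrite eqEsubset /=.
by rewrite !closure_sub_of_fixed // => J /fixE.
Qed.

Lemma fixed_setT star I : closure_operation star -> F0val I = [set: B] -> star I = I.
Proof.
by case=> ext _ _ IT; apply: val_inj; apply/eqP; rewrite eqEsubset /= ext IT subsetT.
Qed.

Hypothesis mulC : commutative (@GRing.mul B).

Lemma colon_unit_F0 (I : {set B}) u v : u * v = 1 -> I \in F0 B -> colon I u \in F0 B.
Proof.
move=> uv /F0P[Is [n [x [y [Ix E]]]]]; apply/F0P; split; first exact: submod_colon.
exists n, (fun i => v * x i), (fun i => u * y i); split=> [i|].
  by rewrite inE mulrA uv mul1r.
rewrite -E; apply: eq_bigr => i _.
by rewrite -mulrA [x i * _]mulC mulrA mulrA [v * u]mulC uv mul1r mulC.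
Qed.

Lemma fixed_colon_unit star I J u v : multiplicative_operation star ->
  u * v = 1 -> F0val J = colon I u -> star I = I <-> star J = J.
Proof.
move=> sm uv JE; split=> fix_; first exact: (fixed_colon sm fix_ JE).
apply: (fixed_colon sm fix_ (b := v)); apply/setP=> x.
by rewrite JE !inE mulrA uv mul1r.
Qed.

(** The line k u is (k : v) for v the inverse of u, and k is closed. *)
Lemma fixed_line star I u v : star_operation star -> u * v = 1 ->
  F0val I = line u -> star I = I.
Proof.
move=> [sm sk] uv IE; apply: (fixed_colon sm sk (b := v)) => /=.
rewrite IE; apply/setP=> x; rewrite inE; apply/lineP/imsetP.
  by case=> c ->; exists c; rewrite // -scalerAr [v * u]mulC uv.
case=> c _ E; exists c; rewrite -[x]mul1r -uv -mulrA E.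
by rewrite -scalerAr mulr1.
Qed.

Lemma id_star : star_operation (id : F0type B -> F0type B).
Proof. by []. Qed.

Lemma F0_small_line (I : {set B}) : I \in F0 B -> (#|I| <= #|k|)%N ->
  exists u v, u * v = 1 /\ I = line u.
Proof.
move=> I0 cI; case: (F0_line_or_plane I0) => // -[x [y [x0 yl /subset_leq_card]]].
rewrite card_add_line; [|exact: submod_line|by []].
rewrite card_line // => /leq_trans/(_ cI); rewrite leqNgt ltn_Pmull //.
  exact: finNzRing_gt1.
by apply/card_gt0P; exists 0.
Qed.

Lemma F0_small_unit (I : {set B}) x : I \in F0 B -> (#|I| <= #|k|)%N ->
  x \in I -> x != 0 -> exists v, x * v = 1.
Proof.
move=> I0 cI; have [u [v [uv ->]]] := F0_small_line I0 cI.
case/lineP=> c ->; rewrite scaler_eq0 negb_or => /andP[c0 _].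
by exists (c^-1 *: v); rewrite -scalerAl -scalerAr uv scalerA mulfV // scale1r.
Qed.

(** The members of [F0] with at most [#|k|] elements are exactly the lines; they stay fixed, and
    everything else closes to [B]. *)
Definition coarse_star I : F0type B :=
  if (#|F0val I| <= #|k|)%N then I else F0Sub (setT_F0 B).

Lemma coarse_star_operation : star_operation coarse_star.
Proof.
have cs I : (#|F0val I| <= #|k|)%N = false -> F0val (coarse_star I) = [set: B].
  by rewrite /coarse_star => ->.
have cs1 I : (#|F0val I| <= #|k|)%N -> coarse_star I = I by rewrite /coarse_star => ->.
split; first split.
- split=> [I|I J IJ|I].
  + by case: (boolP (#|F0val I| <= #|k|)%N) => [/cs1 ->|/negbTE/cs ->] //; apply: subsetT.
  + have [cJ|/negbTE/cs ->] := boolP (#|F0val J| <= #|k|)%N; last exact: subsetT.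
    by rewrite !cs1 // (leq_trans (subset_leq_card IJ)).
  + have [/cs1 E|/negbTE/cs E] := boolP (#|F0val I| <= #|k|)%N; first by rewrite !E.
    by apply: val_inj => /=; rewrite E /coarse_star; case: ifP; rewrite E.
- move=> I b Ib; have [cI|/negbTE/cs E] := boolP (#|F0val I| <= #|k|)%N; last first.
    by apply/subsetP=> x _; rewrite inE E inE.
  rewrite (cs1 I) //; have [c|cIb] := boolP (#|colon I b| <= #|k|)%N.
    by rewrite (cs1 (F0Sub Ib)).
  (* Here I is a line and (I : b) is not. If b x is nonzero for some x in (I : b), it is a unit, so
     b is a unit too, and multiplication by b embeds (I : b) into I, which is too small. *)
  suff b0 : b = 0.
    by apply/subsetP=> x _; rewrite inE b0 mul0r; case: (F0_submod (F0valP I)).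
  apply: (F0_annihilator Ib) => x; rewrite inE => Ix.
  apply/eqP; apply: contraNT cIb => bx0.
  have [w bxw] := F0_small_unit (F0valP I) cI Ix bx0.
  apply: leq_trans cI; rewrite -(card_imset _ (_ : injective (GRing.mul b))).
    by apply/subset_leq_card/subsetP=> _ /imsetP[z + ->]; rewrite inE.
  move=> y z byz; have bi : (x * w) * b = 1 by rewrite mulC mulrA.
  by rewrite -[y]mul1r -[z]mul1r -bi -!mulrA byz.
by apply: cs1 => /=; rewrite /base_set (leq_trans (leq_imset_card _ _)) // max_card.
Qed.

Lemma card_Star_le2 n : (n <= 2)%N -> #|B| = (#|k| ^ n)%N -> #|Star B| = 1%N.
Proof.
move=> n2 cB; have q1 := finNzRing_gt1 k; apply/eqP.
rewrite eqn_leq; apply/andP; split; last first.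
  by apply/card_gt0P; exists [ffun I => I]; rewrite inE; apply/asboolP;
    have := id_star; congr star_operation; apply/funext=> I; rewrite ffunE.
have fix_all star : star_operation star -> forall I, star I = I.
  move=> ss I; have [[u [v [uv IE]]]|[x [y [x0 yl sub]]]] := F0_line_or_plane (F0valP I).
    exact: fixed_line uv IE.
  apply: fixed_setT; first by case: ss => -[].
  apply/eqP; rewrite -subTset; apply: subset_trans sub.
  (* A plane has [#|k| ^ 2] elements, at least as many as [B]. *)
  suff /eqP -> : add_line (line x) y == [set: B] by [].
  rewrite eqEcard subsetT cardsT card_add_line ?card_line ?cB //; last exact: submod_line.
  by rewrite mulnn leq_exp2l.
apply/card_le1P => /= s1; rewrite inE => /asboolP/fix_all f1 s2.
rewrite !inE; apply/asboolP/eqP => [/fix_all f2|->].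
  by apply/ffunP=> I; rewrite f1 f2.
have := id_star; congr star_operation; apply/funext=> I /=; exact: esym (f1 I).
Qed.

End ClosedSubspaces.

(** The second clause is nondegeneracy of the pairing (b, x) |-> lam (b x), so that b |-> lam (b _)
    identifies [B] with its dual. *)
Definition frobenius_form (k : finFieldType) (B : finAlgType k) (lam : B -> k) :=
  (forall a x y, lam (a *: x + y) = a * lam x + lam y) /\
  (forall b, (forall x, lam (b * x) = 0) -> b = 0).

(** The list meets every orbit of the units acting by multiplication; v witnesses that u is
    invertible. Repetitions are harmless, since the length of the list only serves as an upper
    bound. *)
Definition unit_orbit_reps (k : finFieldType) (B : finAlgType k) (rs : seq B) :=
  forall b : B, exists u v r, [/\ u * v = 1, r \in rs & b = u * r].

(** * Dimension 3: lower and upper bounds for the number of star operations *)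

Section CubicAlgebras.
Variables (k : finFieldType) (B : finAlgType k).
Hypothesis mulC : commutative (@GRing.mul B).
Hypothesis cardB : #|B| = (#|k| ^ 3)%N.
Implicit Types (I J : F0type B).

(** The span of 1 and any y outside k works: it lies in [F0] because it contains 1. *)
Lemma exists_proper_plane : exists2 I : F0type B,
  (#|k| < #|F0val I|)%N & F0val I != [set: B].
Proof.
have q1 := finNzRing_gt1 k; have q0 := ltnW q1.
have c1 : #|line (1 : B)| = #|k| by apply/card_line/oner_neq0.
have [y _ yl] : exists2 y : B, y \in [set: B] & y \notin line 1.
  apply/subsetPn/negP => /subset_leq_card.
  by rewrite cardsT cardB c1 leqNgt -[X in (X < _)%N]expn1 ltn_exp2l.
have Fp : add_line (line 1) y \in F0 B.
  apply: mem1_F0; first exact/submod_add_line/submod_line.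
  by apply: (subsetP (sub_add_line _ _)); apply/lineP; exists 1; rewrite scale1r.
have cp : #|add_line (line 1) y| = (#|k| ^ 2)%N.
  by rewrite card_add_line ?c1 ?mulnn //; apply: submod_line.
exists (F0Sub Fp) => /=; first by rewrite cp -[X in (X < _)%N]expn1 ltn_exp2l.
apply/eqP=> /= E; move: cp; rewrite E cardsT cardB => /eqP.
by rewrite eqn_exp2l.
Qed.

Lemma card_Star_ge2 : (2 <= #|Star B|)%N.
Proof.
apply/card_gt1P; exists [ffun I => I], [ffun I => coarse_star I].
have inS (f : F0type B -> F0type B) : star_operation f -> [ffun I => f I] \in Star B.
  move=> fs; rewrite inE; apply/asboolP.
  by have := fs; congr star_operation; apply/funext=> I; rewrite ffunE.
split; [exact/inS/id_star|exact/inS/coarse_star_operation|].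
have [I cI IT] := exists_proper_plane; apply: contraNneq IT => /ffunP/(_ I).
by rewrite !ffunE /coarse_star leqNgt cI => ->.
Qed.

Variables (lam : B -> k) (rs : seq B).
Hypothesis lamF : frobenius_form lam.
Hypothesis rsP : unit_orbit_reps rs.

Definition form_ker : {set B} := [set x | lam x == 0].

Lemma form0 : lam 0 = 0.
Proof.
by have := lamF.1 (-1) 0 0; rewrite scaler0 addr0 mulN1r addNr.
Qed.

Lemma submod_form_ker : submod_closed form_ker.
Proof.
split=> [|a x y]; rewrite !inE ?form0 // => /eqP x0 /eqP y0.
by rewrite lamF.1 x0 y0 mulr0 addr0.
Qed.

Lemma colon_form_ker_proper b : b != 0 -> colon form_ker b != [set: B].
Proof.
apply: contraNneq => /setP bT; apply/eqP/lamF.2 => x.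
by have := bT x; rewrite !inE => /eqP.
Qed.

(* A plane is the kernel of a linear form, and [lam] identifies B with its
   dual; the pigeonhole principle replaces the count of dimensions. *)
Lemma plane_colon_form_ker x y : x != 0 -> y \notin line x ->
  exists2 b, b != 0 & add_line (line x) y = colon form_ker b.
Proof.
move=> x0 yl; have q1 := finNzRing_gt1 k.
have ninj : ~ injective (fun b => (lam (b * x), lam (b * y))).
  by move=> /leq_card; rewrite card_prod cardB mulnn leq_exp2l.
have [b1 [b2 [Ex Ey b12]]] : exists b1 b2,
    [/\ lam (b1 * x) = lam (b2 * x), lam (b1 * y) = lam (b2 * y) & b1 <> b2].
  apply: contrapT => no; apply: ninj => b1 b2 [Ex Ey].
  by apply: contrapT => b12; apply: no; exists b1, b2.
have lamB z : lam ((b1 - b2) * z) = lam (b1 * z) - lam (b2 * z).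
  by rewrite mulrBl addrC -scaleN1r lamF.1 mulN1r addrC.
have b0 : b1 - b2 != 0 by rewrite subr_eq0; apply/eqP.
have Ks := submod_colon (b1 - b2) submod_form_ker.
exists (b1 - b2) => //.
have [||||->|] // := @submod_subset_card _ _ (add_line (line x) y)
  (colon form_ker (b1 - b2)) 2 cardB.
- exact/submod_add_line/submod_line.
- apply: add_line_sub => //; last by rewrite !inE lamB Ey subrr.
  by apply: line_sub => //; rewrite !inE lamB Ex subrr.
- by rewrite card_add_line ?card_line ?mulnn //; apply: submod_line.
by move=> E; have := colon_form_ker_proper b0; rewrite E eqxx.
Qed.

(** The existential says at once that the colon by the representative lies in [F0] and that it is
    closed. *)
Definition fixed_reps (star : F0type B -> F0type B) : {set 'I_(size rs)} :=
  [set i : 'I_(size rs) |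
    [exists I : F0type B, (F0val I == colon form_ker rs`_i) && (star I == I)]].

(** Lines and [B] are closed for every star operation. A proper plane is (ker lam : b) with b = u r;
    its colon by the inverse v of u is (ker lam : r), which is closed exactly when the plane is, and
    this is recorded in [fixed_reps]. *)
Lemma fixed_reps_sub (star1 star2 : F0type B -> F0type B) :
  star_operation star1 -> star_operation star2 ->
  fixed_reps star1 = fixed_reps star2 -> forall I, star1 I = I -> star2 I = I.
Proof.
move=> s1 s2 E I fI.
have [[u [v [uv IE]]]|[x [y [x0 yl sub]]]] := F0_line_or_plane (F0valP I).
  exact: (fixed_line mulC s2 uv IE).
have [|||IT|IT] := @submod_subset_card _ _ _ (F0val I) 2 cardB _ _ sub.
- exact/submod_add_line/submod_line.
- exact: F0_submod (F0valP I).
- by rewrite card_add_line ?card_line ?mulnn //; apply: submod_line.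
- have [b b0 bE] := plane_colon_form_ker x0 yl; rewrite bE in IT.
  have [u [v [r [uv rrs bur]]]] := rsP b.
  have vu : v * u = 1 by rewrite mulC.
  have IrE : colon form_ker r = colon (F0val I) v.
    by apply/setP=> z; rewrite IT bur !inE [u * r]mulC mulrA -[r * u * v]mulrA uv mulr1.
  have Ir0 : colon form_ker r \in F0 B.
    by rewrite IrE; apply: (colon_unit_F0 mulC vu); apply: F0valP.
  have ir : (index r rs < size rs)%N by rewrite index_mem.
  have : Ordinal ir \in fixed_reps star1.
    rewrite inE; apply/existsP; exists (F0Sub Ir0); rewrite /= nth_index // eqxx /=.
    by apply/eqP; exact: (fixed_colon s1.1 (J := F0Sub Ir0) fI IrE).
  rewrite E inE => /existsP[J /andP[/eqP]]; rewrite /= nth_index // => JE /eqP fJ.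
  by apply/(fixed_colon_unit s2.1 vu (J := J)); rewrite // JE.
- by apply: fixed_setT => //; case: s2 => -[].
Qed.

(** A closure operation is determined by its fixed points, so [fixed_reps] is injective on star
    operations. *)
Lemma card_Star_le_reps : (#|Star B| <= 2 ^ size rs)%N.
Proof.
rewrite -[in leqRHS](card_ord (size rs)) -cardsT -card_powerset powersetT cardsT.
apply: (@leq_card_in _ _ (fun star : {ffun _} => fixed_reps star)) => s1 s2.
rewrite !inE => /asboolP ss1 /asboolP ss2 E; apply/ffunP.
apply: closure_eq_fixed; [by case: ss1 => -[]|by case: ss2 => -[]|].
move=> I; split; first exact: fixed_reps_sub ss1 ss2 E I.
exact: fixed_reps_sub ss2 ss1 (esym E) I.
Qed.

End CubicAlgebras.

(** * Units and top coefficients in L[X]/(X^f) *)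

Section TruncatedPolynomials.
Variables (L : finFieldType) (f : nat).
Hypothesis f_gt0 : (0 < f)%N.
Local Notation A := {poly %/ ('X^f : {poly L})}.

(** For f = 0 the modulus would be constant and [mk_monic] would replace it by its default value. *)
Lemma mk_monic_Xf : mk_monic ('X^f : {poly L}) = 'X^f.
Proof. by rewrite /mk_monic size_polyXn ltnS f_gt0 monicXn. Qed.

Lemma val_in_qpoly_Xn (p : {poly L}) : val (in_qpoly 'X^f p) = p %% 'X^f.
Proof. by rewrite /= mk_monic_Xf -Pdiv.IdomainMonic.modpE // monicXn. Qed.

Lemma size_truncated (b : A) : (size (val b) <= f)%N.
Proof. by rewrite -ltnS (leq_trans (size_mk_monic b)) // mk_monic_Xf size_polyXn. Qed.

(** Split off the highest power of X dividing b: the cofactor is prime to X, hence invertible modulo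
    X^f by Bezout. *)
Lemma truncated_unit_Xn (b : A) : exists (u v : A) (j : 'I_f.+1),
  u * v = 1 /\ b = u * in_qpoly 'X^f 'X^j.
Proof.
have [m [c c0 bE]] := multiplicity_XsubC (val b) 0.
have [b0|b0] := eqVneq (val b) 0.
  (* The zero element is the case j = f, since X^f vanishes in the quotient. *)
  exists 1, 1, ord_max; rewrite mulr1; split=> //; rewrite mul1r; apply: val_inj.
  by rewrite val_in_qpoly_Xn modpp.
rewrite b0 implyTb in c0; rewrite subr0 in bE.
have mf : (m < f.+1)%N.
  have := size_truncated b; rewrite bE.
  have c_neq0 : c != 0 by apply: contraNneq b0 => c_eq0; rewrite bE c_eq0 mul0r.
  rewrite size_mulXn // => /(leq_trans (leq_addr _ _)) mf.
  exact: leq_trans mf _.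
have : coprimep c ('X^f).
  by rewrite coprimep_expr // -['X]subr0 coprimep_XsubC.
case/Bezout_coprimepP=> -[v w] /=.
(* The Bezout identity holds only up to a nonzero scalar, whence the correction c1 / c2 in the
   inverse. *)
rewrite -[X in _ %= X]/1%:P => /eqpP[[c1 c2] /= /andP[c10 c20] vw].
have uv : in_qpoly 'X^f c * in_qpoly 'X^f ((c1 / c2) *: v) = 1.
  rewrite -in_qpolyM -in_qpoly1; apply: val_inj; rewrite !val_in_qpoly_Xn.
  have -> : c * ((c1 / c2) *: v) = 1 - (c1 / c2) *: w * 'X^f.
    apply: (scalerI c20); rewrite scalerBr -vw scalerDr -!scalerAl -scalerAr.
    by rewrite !scalerA mulrCA mulfV // mulr1 [c * v]mulrC addrK.
  by rewrite modpD modpN modp_mull oppr0 addr0.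
exists (in_qpoly 'X^f c), (in_qpoly 'X^f ((c1 / c2) *: v)), (Ordinal mf).
split=> //; rewrite -in_qpolyM /= -bE; apply: val_inj.
by rewrite val_in_qpoly_Xn modp_small // size_polyXn ltnS size_truncated.
Qed.

(** Write b = u X^j with u a unit and j < f; multiplying by u^-1 a X^(f-1-j) gives a X^(f-1). *)
Lemma truncated_socle (b : A) (a : L) : b != 0 ->
  exists x : A, (val (b * x))`_f.-1 = a.
Proof.
move=> b0; have [u [v [j [uv bE]]]] := truncated_unit_Xn b.
have jf : (j < f)%N.
  rewrite ltnNge; apply: contraNN b0 => fj; rewrite bE.
  have -> : in_qpoly 'X^f 'X^j = 0 :> A.
    by apply: val_inj; rewrite val_in_qpoly_Xn -(subnK fj) exprD modp_mull.
  by rewrite mulr0.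
have jf1 : (j <= f.-1)%N by rewrite -ltnS prednK.
exists (v * in_qpoly 'X^f (a *: 'X^(f.-1 - j))).
rewrite bE mulrACA uv mul1r -in_qpolyM -scalerAr -exprD subnKC //.
rewrite val_in_qpoly_Xn modp_small; first by rewrite coefZ coefXn eqxx mulr1.
by rewrite size_polyXn (leq_ltn_trans (size_scale_leq _ _)) // size_polyXn prednK.
Qed.
End TruncatedPolynomials.

(** * Frobenius forms and orbit representatives for local factors and their products *)

Lemma ex_nonzero_form (k : finFieldType) (L : fieldExtType k) :
  exists mu : L -> k, (forall c x y, mu (c *: x + y) = c * mu x + mu y) /\
    exists a, mu a != 0.
Proof.
have d : (0 < \dim {:L})%N by rewrite adim_gt0.
exists (coord (vbasis {:L}) (Ordinal d)); split=> [c x y|]; first exact: linearP.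
exists (vbasis {:L})`_(Ordinal d).
by have -> := coord_free (Ordinal d) (Ordinal d) (basis_free (vbasisP {:L}));
  rewrite eqxx oner_neq0.
Qed.

Lemma truncated_mulC (L : finFieldType) f : commutative (@GRing.mul (truncated_poly L f)).
Proof. exact: (@mulrC {poly %/ ('X^f : {poly L})}). Qed.

Lemma local_factor_mulC (k : finFieldType) p :
  commutative (@GRing.mul (local_factor k p)).
Proof. exact: (@truncated_mulC (fin_ext k p.1) p.2). Qed.

(** The form is the coefficient of X^(f-1) followed by a nonzero k-linear form mu on the residue
    field. The multiples of a nonzero b realise every top coefficient, in particular one on which mu
    does not vanish. *)
Lemma ex_frobenius_local (k : finFieldType) p : (0 < p.2)%N ->
  exists lam : local_factor k p -> k, frobenius_form lam.
Proof.
move=> f0; have [mu [muL [a mua]]] := ex_nonzero_form (field_ext k p.1).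
pose A := {poly %/ ('X^(p.2) : {poly fin_ext k p.1})}.
exists (fun x => mu (val (x : A))`_(p.2.-1)); split=> [c x y|b bx].
  rewrite [val _]/= coefD coefZ -[_ * _]scalerAl mul1r; exact: muL.
apply: contraNeq mua => b0.
have [x <-] := @truncated_socle (fin_ext k p.1) p.2 f0 b a b0.
by apply/eqP/bx.
Qed.

Lemma ex_orbit_reps_local (k : finFieldType) p : (0 < p.2)%N ->
  exists2 rs : seq (local_factor k p), size rs = p.2.+1 & unit_orbit_reps rs.
Proof.
move=> f0; pose L : finFieldType := fin_ext k p.1.
pose monomial j : local_factor k p := in_qpoly 'X^(p.2) ('X^j : {poly L}).
exists (map monomial (iota 0 p.2.+1)); first by rewrite size_map size_iota.
move=> b; have [u [v [j [uv bE]]]] := @truncated_unit_Xn L p.2 f0 b.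
exists u, v, (monomial j); split=> //.
by apply: map_f; rewrite mem_iota ltn_ord.
Qed.

(** The three properties are bundled so that they pass through products together by induction on the
    factors. *)
Definition frobenius_with_orbits (k : finFieldType) (B : finAlgType k) (N : nat) :=
  [/\ commutative (@GRing.mul B), exists lam : B -> k, frobenius_form lam
    & exists2 rs : seq B, size rs = N & unit_orbit_reps rs].

Lemma frobenius_with_orbits_local (k : finFieldType) p : (0 < p.2)%N ->
  frobenius_with_orbits (local_factor k p) p.2.+1.
Proof.
move=> f0; split; [exact: local_factor_mulC|exact: ex_frobenius_local|].
exact: ex_orbit_reps_local.
Qed.

(** The forms are added and the representatives paired. Nondegeneracy is tested on (x, 0) and (0, x)
    separately. *)
Lemma frobenius_with_orbits_prod (k : finFieldType) (A B : finAlgType k) M N :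
  frobenius_with_orbits A M -> frobenius_with_orbits B N ->
  frobenius_with_orbits (A * B)%type (M * N).
Proof.
move=> [Ac [lA [lAl lAn]] [rA <- rAP]] [Bc [lB [lBl lBn]] [rB <- rBP]]; split.
- by move=> [a b] [a' b']; congr (_, _); [apply: Ac|apply: Bc].
- exists (fun x => lA x.1 + lB x.2); split=> [c [x x'] [y y']|[b b'] bx].
    by rewrite /= lAl lBl mulrDr addrACA.
  congr (_, _).
    apply: lAn => x; have := bx (x, 0); rewrite /= mulr0.
    by have := lBl (-1) 0 0; rewrite scaler0 addr0 mulN1r addNr => ->; rewrite addr0.
  apply: lBn => x; have := bx (0, x); rewrite /= mulr0.
  by have := lAl (-1) 0 0; rewrite scaler0 addr0 mulN1r addNr => ->; rewrite add0r.
exists [seq (r, r') | r <- rA, r' <- rB]; first by rewrite size_allpairs.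
move=> [b b']; have [u [v [r [uv rin ->]]]] := rAP b.
have [u' [v' [r' [uv' rin' ->]]]] := rBP b'.
exists (u, u'), (v, v'), (r, r'); split=> //; first by congr (_, _).
by apply/allpairsP; exists (r, r').
Qed.

Definition num_orbits (s : seq (nat * nat)) : nat := \prod_(p <- s) p.2.+1.

Lemma frobenius_with_orbits_Balg (k : finFieldType) s : s <> [::] -> positive_pairs s ->
  frobenius_with_orbits (Balg k s) (num_orbits s).
Proof.
case: s => // p s _; rewrite /Balg /num_orbits /=.
elim: s p => [|p' s IHs] p /andP[/andP[_ f0] ps].
  by rewrite big_seq1; apply: frobenius_with_orbits_local.
by rewrite big_cons; apply: frobenius_with_orbits_prod;
  [apply: frobenius_with_orbits_local|apply: IHs].
Qed.

(** * From bounds on [Lambda] to values and limits of [theta] *)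

Lemma prime_power_gt1 q : prime_power q -> (1 < q)%N.
Proof. by move=> [p [r [/prime_gt1 p1 r0 ->]]]; rewrite -(expn0 p) ltn_exp2l. Qed.

Lemma elog_fin (R : realType) (b x : R) : 0 < x -> elog b x%:E = (ln x / ln b)%:E.
Proof. by move=> x0; rewrite /elog lne_EFin // EFinM. Qed.

Lemma elog0 (R : realType) (b : R) : 1 < b -> elog b 0 = -oo%E.
Proof.
by move=> b1; rewrite /elog le0_lneNy // gt0_mulNye // lte_fin invr_gt0 ln_gt0.
Qed.

Lemma theta_Lambda1 (R : realType) s q : prime_power q -> Lambda s q = 1%N ->
  theta R s q = -oo%E.
Proof.
move=> /prime_power_gt1 q1 L1; rewrite /theta L1 elog_fin // ln1 mul0r.
by rewrite elog0 // ltr1n.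
Qed.

(** The binary logarithm of [Lambda s q] lies between 1 and N, and the logarithm in base q is
    increasing. *)
Lemma theta_bounds (R : realType) s q N : prime_power q ->
  (2 <= Lambda s q)%N -> (Lambda s q <= 2 ^ N)%N ->
  (0 <= theta R s q <= (ln N%:R / ln q%:R)%:E)%E.
Proof.
move=> /prime_power_gt1 q1 L2 LN.
have q1R : 1 < q%:R :> R by rewrite ltr1n.
have lq : 0 < ln q%:R :> R by rewrite ln_gt0.
have l2 : 0 < ln 2 :> R by rewrite ln_gt0 // ltr1n.
have L0 : 0 < (Lambda s q)%:R :> R by rewrite ltr0n (leq_trans _ L2).
have t1 : 1 <= ln (Lambda s q)%:R / ln 2 :> R.
  by rewrite ler_pdivlMr // mul1r ler_ln ?posrE // ler_nat.
have tN : ln (Lambda s q)%:R / ln 2 <= N%:R :> R.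
  rewrite ler_pdivrMr // mulr_natl -lnXn // ler_ln ?posrE ?exprn_gt0 //.
  by rewrite -natrX ler_nat.
rewrite /theta !elog_fin ?(lt_le_trans _ t1) // !lee_fin divr_ge0 ?ln_ge0 ?(ltW lq) //=.
rewrite ler_pM2r ?invr_gt0 // ler_ln ?posrE ?(lt_le_trans _ t1) //.
  by rewrite (lt_le_trans _ tN) // (lt_le_trans _ t1).
exact: ltW.
Qed.

Local Open Scope classical_set_scope.

(** Since N does not depend on q, ln N / ln q tends to 0 and squeezes [theta]. The filter is
    restricted to prime powers, where the bounds are assumed. *)
Lemma theta_cvg0 (R : realType) s N :
  (forall q, prime_power q -> (2 <= Lambda s q)%N /\ (Lambda s q <= 2 ^ N)%N) ->
  theta R s q @[q --> within prime_power \oo] --> 0%E.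
Proof.
move=> LP.
have Finf : Filter (within prime_power \oo) by exact: within_filter.
have ln_oo : (ln q%:R : R) @[q --> \oo] --> (+oo : set_system R)%R.
  apply/cvgryPge => A; near=> q.
  have : expR A <= q%:R by near: q; exact: nbhs_infty_ger.
  by move=> Aq; rewrite -ler_expR lnK // posrE (lt_le_trans (expR_gt0 A)).
have ln_inv : (ln q%:R)^-1 @[q --> \oo] --> (0 : R).
  apply/gtr0_cvgV0 => //; near=> q; rewrite ln_gt0 // ltr1n.
  by near: q; exists 2%N.
have ln0 : (ln N%:R / ln q%:R)%:E @[q --> within prime_power \oo] --> (0 : R)%:E.
  apply: cvg_EFin; first exact: nearW.
  rewrite -(mulr0 (ln N%:R)); apply: cvgM; first exact: cvg_cst.
  exact: cvg_trans (cvg_app _ (cvg_within _)) ln_inv.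
apply: (squeeze_cvge _ (cvg_cst _) ln0).
rewrite near_withinE; apply: nearW => q qP.
by have [L2 LN] := LP q qP; apply: theta_bounds.
Unshelve. all: by end_near. Qed.

Theorem proposition3p9 (R : realType) (s : seq (nat * nat))
    (s_nonempty : s <> [::]) (s_pos : positive_pairs s) :
  ((total_degree s <= 2)%N ->
     forall q : nat, prime_power q -> theta R s q = -oo%E) /\
  (total_degree s = 3%N ->
     theta R s q @[q --> within prime_power \oo] --> 0%E).
Proof.
have cardB q := card_Balg (GF q) s_nonempty s_pos.
have dataB q := frobenius_with_orbits_Balg (GF q) s_nonempty s_pos.
split=> [n2 q qP|n3].
  have [mulC _ _] := dataB q.
  exact: theta_Lambda1 qP (card_Star_le2 mulC n2 (cardB q)).
(* The exponent [num_orbits s] is read off from s alone, so the bound is uniform in q. *)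
apply: (@theta_cvg0 _ _ (num_orbits s)) => q _.
have [mulC [lam lamF] [rs <- rsP]] := dataB q.
have card3 := cardB q; rewrite n3 in card3.
split; [exact: card_Star_ge2|exact: card_Star_le_reps lamF rsP].
Qed.
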